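(* Let $d\ge2$ be an integer, $\Omega\subset\mathbb{R}^{d-1}$ a bounded open Lipschitz domain, $\mathcal{A}$ an algebra with mean value on $\mathbb{R}^{d-1}$, and $h_1,h_2\in W^{1,\infty}(\mathbb{R}^{d-1})\cap\mathcal{A}$ Lipschitz continuous functions. Put $$\Omega^\varepsilon=\Big\{x=(\overline{x},x_d)\in\mathbb{R}^d:\overline{x}\in\Omega,\ \varepsilon h_1\big(\tfrac{\overline{x}}{\varepsilon}\big)<x_d<\varepsilon h_2\big(\tfrac{\overline{x}}{\varepsilon}\big)\Big\},$$ $I=(\min_{\mathbb{R}^{d-1}}h_1,\max_{\mathbb{R}^{d-1}}h_2)$, assume $0\in[\min_{\mathbb{R}^{d-1}}h_1,\max_{\mathbb{R}^{d-1}}h_2]$, and put $G_\varepsilon=\Omega\times\varepsilon I$, $G_0=\Omega\times\{0\}$ (identified with $\Omega$), and $$\mathbb{J}=\{y=(\overline{y},y_d)\in\mathbb{R}^d:\overline{y}\in\mathbb{R}^{d-1},\ h_1(\overline{y})<y_d<h_2(\overline{y})\}$$ with characteristic function $\chi_{\mathbb{J}}$. Let $1<p<\infty$, $1/p'=1-1/p$, let $E$ be an ordinary sequence and let $(u_\varepsilon)_{\varepsilon\in E}$, $u_\varepsilon\in L^p(\Omega^\varepsilon)$, satisfy $\sup_{\varepsilon\in E}\varepsilon^{-1/p}\|u_\varepsilon\|_{L^p(\Omega^\varepsilon)}\le C$ with $C>0$ independent of $\varepsilon$. Assume that there is a continuous extension operator $P_\varepsilon:L^p(\Omega^\varepsilon)\to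 L^p(G_\varepsilon)$ with $\|P_\varepsilon v\|_{L^p(G_\varepsilon)}\le C\|v\|_{L^p(\Omega^\varepsilon)}$ for all $v\in L^p(\Omega^\varepsilon)$, $C>0$ being independent of $\varepsilon$. Let $E'$ be a subsequence of $E$ and $u_0\in L^p(G_0;\mathcal{B}^p_{\mathcal{A}}(\mathbb{R}^{d-1};L^p(I)))$ be such that $P_\varepsilon u_\varepsilon\to u_0$ in $L^p(G_\varepsilon)$-weak $\Sigma_{\mathcal{A}}$ as $E'\ni\varepsilon\to0$. Then, as $E'\ni\varepsilon\to0$, $$\frac1\varepsilon\int_{\Omega^\varepsilon}u_\varepsilon(x)f\Big(\overline{x},\frac{x}{\varepsilon}\Big)dx\longrightarrow\int_{G_0}\int_I M\big(\chi_{\mathbb{J}}(\cdot,y_d)\,u_0(\overline{x},\cdot,y_d)f(\overline{x},\cdot,y_d)\big)\,dy_d\,d\overline{x}$$ for all $f\in L^{p'}(G_0;\mathcal{A}(\mathbb{R}^{d-1};\mathcal{C}(\overline{I})))$.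
   Context: An ordinary sequence is a sequence $(\varepsilon_n)$ with $0<\varepsilon_n\le1$, $\varepsilon_n\to0$. Here $\min$ and $\max$ over $\mathbb{R}^{d-1}$ are understood as infimum and supremum. $f(\overline{x},x/\varepsilon)=f(\overline{x},\overline{x}/\varepsilon,x_d/\varepsilon)$. Such $E'$ and $u_0$ always exist (weak $\Sigma$-compactness of sequences with $\varepsilon^{-1/p}\|v_\varepsilon\|_{L^p(G_\varepsilon)}$ bounded). Algebra with mean value on $\mathbb{R}^m$: a closed subalgebra $\mathcal{A}$ of the algebra $\mathrm{BUC}(\mathbb{R}^m)$ of bounded uniformly continuous real functions (sup norm) which contains the constants, is translation invariant, and such that for every $u\in\mathcal{A}$ the functions $x\mapsto u(x/\varepsilon)$ converge weakly-$*$ in $L^\infty(\mathbb{R}^m)$, as $\varepsilon\to0$, to a real constant $M(u)$ (mean value); $M(u)=\lim_{R\to\infty}|B_R|^{-1}\int_{B_R}u\,dy$. For a Banach space $\mathbb{F}$, $\mathcal{A}(\mathbb{R}^m;\mathbb{F})$ is the closure in $\mathrm{BUC}(\mathbb{R}^m;\mathbb{F})$ of the finite sums $\sum u_iv_i$, $u_i\in\mathcal{A}$, $v_i\in\mathbb{F}$. With $\|u\|_p=\big(\limsup_{R\to\infty}|B_R|^{-1}\int_{B_R}\|u(y)\|_{\mathbb{F}}^p\,dy\big)^{1/p}$, $B^p_{\mathcal{A}}(\mathbb{R}^m;\mathbb{F})$ is the closure of $\mathcal{A}(\mathbb{R}^m;\mathbb{F})$ for this seminorm in $\{u\in L^p_{loc}(\mathbb{R}^m;\mathbb{F}):\|u\|_p<\infty\}$,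 and $\mathcal{B}^p_{\mathcal{A}}(\mathbb{R}^m;\mathbb{F})$ is its quotient by $\{u:\|u\|_p=0\}$, a Banach space. $M$ extends by continuity to $B^p_{\mathcal{A}}(\mathbb{R}^m;\mathbb{F})$ and $\mathcal{B}^p_{\mathcal{A}}(\mathbb{R}^m;\mathbb{F})$ with values in $\mathbb{F}$. Weak $\Sigma$-convergence: $v_\varepsilon\to v_0$ in $L^p(G_\varepsilon)$-weak $\Sigma_{\mathcal{A}}$, where $v_\varepsilon\in L^p(G_\varepsilon)$ and $v_0\in L^p(G_0;\mathcal{B}^p_{\mathcal{A}}(\mathbb{R}^{d-1};L^p(I)))$, means $\varepsilon^{-1}\int_{G_\varepsilon}v_\varepsilon(x)f(\overline{x},x/\varepsilon)dx\to\int_{G_0}\int_IM(v_0(\overline{x},\cdot,\zeta)f(\overline{x},\cdot,\zeta))d\zeta d\overline{x}$ for all $f\in L^{p'}(G_0;\mathcal{A}(\mathbb{R}^{d-1};L^{p'}(I)))$. The mean value is taken in the variable of $\mathbb{R}^{d-1}$. *)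

(* Defs.v *)
From HB Require Import structures.
From mathcomp Require Import all_boot all_order all_algebra.
From mathcomp Require Import all_classical all_reals all_analysis.

Set Implicit Arguments.
Unset Strict Implicit.
Unset Printing Implicit Defensive.

Import Order.TTheory GRing.Theory Num.Theory.
Import numFieldNormedType.Exports.

Local Open Scope classical_set_scope.
Local Open Scope ring_scope.

Definition rV_display : measure_display -> measure_display.
Proof. exact. Qed.

(* The product sigma-algebra on row vectors; for T = R it is the Borel one. *)
Section measurable_rV.
Context {d} {T : sigmaRingType d}.
Context (n : nat).

Let coord : 'I_n -> 'rV[T]_n -> T := fun i x => x ord0 i.

Let rV_set0 : g_sigma_preimage coord set0.
Proof. exact: sigma_algebra0. Qed.

Let rV_setC A : g_sigma_preimage coord A -> g_sigma_preimage coord (~` A).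
Proof. exact: sigma_algebraC. Qed.

Let rV_bigcup (F : _^nat) : (forall i, g_sigma_preimage coord (F i)) ->
  g_sigma_preimage coord (\bigcup_i (F i)).
Proof. exact: sigma_algebra_bigcup. Qed.

HB.instance Definition _ := @isMeasurable.Build (rV_display d)
  'rV[T]_n (g_sigma_preimage coord) rV_set0 rV_setC rV_bigcup.

End measurable_rV.

Section lebesgue_rV.
Context {R : realType}.

Definition rV_snoc n (x : 'rV[R]_n * R) : 'rV[R]_n.+1 :=
  \row_i oapp (fun j => x.1 ord0 j) x.2 (unlift ord_max i).

Lemma measurable_rV_coord n (i : 'I_n) :
  measurable_fun [set: 'rV[R]_n] (fun x => x ord0 i).
Proof.
move=> _ Y mY; rewrite setTI; apply: sub_sigma_algebra => /=.
rewrite -bigcup_seq/=; exists i => /=; first by rewrite mem_index_enum.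
by exists Y => //; rewrite setTI.
Qed.

Lemma measurable_rV_snoc n : measurable_fun [set: 'rV[R]_n * R] (@rV_snoc n).
Proof.
pose f (i : 'I_n.+1) (x : 'rV[R]_n.+1) : R := x ord0 i.
suff mf i : measurable_fun [set: 'rV[R]_n * R] (f i \o @rV_snoc n).
  have h : g_sigma_preimage (fun i => f i \o @rV_snoc n) `<=` measurable.
    apply: smallest_sub; first exact: sigma_algebra_measurable.
    rewrite -bigcup_mkord_ord; apply: bigcup_sub => i _ A [B mB <-].
    exact: mf.
  move: h; rewrite g_sigma_preimage_comp => h _ A mA.
  by apply: h; exists A.
have [j ->|->] := unliftP ord_max i.
- rewrite (_ : _ \o _ = (fun y : 'rV[R]_n => y ord0 j) \o fst).
    by apply: measurableT_comp; [exact: measurable_rV_coord|].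
  by apply/funext => x /=; rewrite /f /rV_snoc mxE liftK.
- rewrite (_ : _ \o _ = snd) //.
  by apply/funext => x /=; rewrite /f /rV_snoc mxE unlift_none.
Qed.

Section lebesgue_rV_succ.
Context (n : nat) (mu : {measure set 'rV[R]_n -> \bar R}).
Local Open Scope ereal_scope.

Definition leb_succ : set 'rV[R]_n.+1 -> \bar R :=
  pushforward (mu \x lebesgue_measure) (@rV_snoc n).

HB.instance Definition _ := Measure.copy leb_succ
  (measure_function_pushforward__canonical__measure_function_Measure
    (mu \x lebesgue_measure) (@measurable_rV_snoc n)).

End lebesgue_rV_succ.

(* Lebesgue measure on the Borel sets of R^n. *)
Fixpoint leb n : {measure set 'rV[R]_n -> \bar R} :=
  if n is n'.+1 then leb_succ (leb n') else dirac (0 : 'rV[R]_0).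

End lebesgue_rV.

Section geometry.
Context {R : realType} {n : nat}.
Implicit Types (x : 'rV[R]_n) (Omega : set 'rV[R]_n) (h : 'rV[R]_n -> R).

Definition euclidean_norm x : R := Num.sqrt (\sum_i x ord0 i ^+ 2).

Definition eball (r : R) : set 'rV[R]_n := [set x | euclidean_norm x < r].

(* Near each boundary point, and after an orthogonal change of coordinates
   z = (x - x0) Q, Omega is the part above the graph of a Lipschitz function
   of the coordinates of z other than the i-th one. *)
Definition lipschitz_boundary Omega :=
  forall x0, (closure Omega `\` interior Omega) x0 ->
  exists (r : R) (Q : 'M[R]_n) (i : 'I_n) (gamma : 'rV[R]_n.-1 -> R),
    [/\ 0 < r, Q *m Q^T = 1%:M, lipschitz gamma &
      forall x, ball x0 r x ->
        let z := (x - x0) *m Q in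
        Omega x <-> gamma (col' i z) < z ord0 i].

Definition bounded_lipschitz_domain Omega :=
  [/\ open Omega, connected Omega, bounded_set Omega &
      lipschitz_boundary Omega].

Definition iter_partial (s : seq 'I_n) (phi : 'rV[R]_n -> R) : 'rV[R]_n -> R :=
  foldr (fun i g x => 'D_(delta_mx ord0 i) g x) phi s.

Definition test_function (phi : 'rV[R]_n -> R) :=
  [/\ forall s, continuous (iter_partial s phi),
      forall s i x, derivable (iter_partial s phi) x (delta_mx ord0 i) &
      compact (closure [set x | phi x != 0])].

(* W^{1,oo}(R^n): essentially bounded functions with essentially bounded weak
   partial derivatives. *)
Definition W1infty h :=
  h \in Lfun (leb n) +oo%E /\
  forall i, exists2 g : 'rV[R]_n -> R, g \in Lfun (leb n) +oo%E &
    forall phi, test_function phi ->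
      \int[leb n]_x (h x * 'D_(delta_mx ord0 i) phi x) =
      - \int[leb n]_x (g x * phi x).

(* The interval I; the extrema over R^n are infimum and supremum. *)
Definition height_itv (h1 h2 : 'rV[R]_n -> R) : set R :=
  `]inf (range h1), sup (range h2)[%classic.

Definition thin_domain Omega (h1 h2 : 'rV[R]_n -> R) (eps : R) :
    set ('rV[R]_n * R) :=
  [set x | Omega x.1 /\
    eps * h1 (eps^-1 *: x.1) < x.2 < eps * h2 (eps^-1 *: x.1)].

Definition thin_cylinder Omega (I : set R) (eps : R) : set ('rV[R]_n * R) :=
  Omega `*` [set eps * t | t in I].

Definition reference_cell (h1 h2 : 'rV[R]_n -> R) : set ('rV[R]_n * R) :=
  [set y | h1 y.1 < y.2 < h2 y.1].

End geometry.

Section Lebesgue_spaces.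
Context {d} {T : measurableType d} {R : realType}.
Context (mu : {measure set T -> \bar R}) (D : set T) (q : R).

(* L^q(D), a function on D being extended by 0. *)
Definition Lp : set (T -> R) := [set v | v \_ D \in Lfun mu q%:E].

Definition Lp_norm (v : T -> R) : \bar R := 'N[mu]_q%:E[EFin \o (v \_ D)]%E.

End Lebesgue_spaces.

(* A normed space of classes of functions, given by the set [felt] of the
   representatives and by the norm [fnrm]: two representatives at distance 0
   are the same vector.  Working with representatives keeps expressions such
   as f(x, x/eps) literal. *)
Record fspace (R : realType) := FSpace {
  fcarrier :> lmodType R;
  felt : set fcarrier;
  fnrm : fcarrier -> \bar R }.
Arguments felt {R} f.
Arguments fnrm {R} f.

(* L^q(I) *)
Definition Lp_space (R : realType) (I : set R) (q : R) : fspace R :=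
  @FSpace R (R -> R^o) (Lp lebesgue_measure I q) (Lp_norm lebesgue_measure I q).

(* C(K) with the sup norm (the extension by 0 makes the norm 0 for K empty). *)
Definition C_space (R : realType) (K : set R) : fspace R :=
  @FSpace R (R -> R^o) [set v : R -> R^o | {within K, continuous v}]
    (fun v => ereal_sup (range (fun z => (`|(v \_ K) z|)%:E))).

Section Bochner_spaces.
Context {d} {T : measurableType d} {R : realType}.
Context (mu : {measure set T -> \bar R}) (D : set T) (F : fspace R).

Definition simple_on (s : T -> F) :=
  [/\ finite_set (s @` D), forall v, measurable (D `&` s @^-1` [set v]) &
      forall x, D x -> felt F (s x)].

Definition strongly_measurable (f : T -> F) :=
  exists2 s : nat -> T -> F, forall k, simple_on (s k) &
    {ae mu, forall x, D x ->
      fnrm F (f x - s k x) @[k --> \oo] --> 0%E}.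

(* L^q(D; F) *)
Definition Bochner (q : R) : set (T -> F) :=
  [set f | [/\ strongly_measurable f,
    {ae mu, forall x, D x -> felt F (f x)} &
    ('N[mu]_q%:E[(fun x => fnrm F (f x)) \_ D] < +oo)%E]].

End Bochner_spaces.

Section algebra_with_mean_value.
Context {R : realType} {n : nat}.
Implicit Types (A : set ('rV[R]_n -> R)) (u : 'rV[R]_n -> R) (F : fspace R).

(* u(x/eps) -> c weakly-* in L^oo(R^n) as eps -> 0 *)
Definition has_mean u (c : R) :=
  forall phi, phi \in Lfun (leb n) 1%E ->
    \int[leb n]_x (u (eps^-1 *: x) * phi x) @[eps --> 0^'+] -->
      c * \int[leb n]_x phi x.

Definition algebra_with_mean_value A :=
  (forall u, A u -> bounded_fun u /\ unif_continuous u) /\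
  (forall c : R, A (fun=> c)) /\
  (forall u v, A u -> A v -> A (fun x => u x + v x)) /\
  (forall u v, A u -> A v -> A (fun x => u x * v x)) /\
  (forall u, (forall e : R, 0 < e ->
       exists2 v, A v & forall x, `|u x - v x| <= e) -> A u) /\
  (forall a u, A u -> A (fun x => u (x + a))) /\
  (forall u, A u -> exists c, has_mean u c).

Definition sup_norm F (w : 'rV[R]_n -> F) : \bar R :=
  ereal_sup (range (fun y => fnrm F (w y))).

Definition BUC F : set ('rV[R]_n -> F) :=
  [set w | [/\ forall y, felt F (w y), (sup_norm w < +oo)%E &
    forall e : R, 0 < e -> exists2 r : R, 0 < r &
      forall y z, ball y r z -> (fnrm F (w y - w z)%R < e%:E)%E]].

Definition finite_sum F k (u : 'I_k -> 'rV[R]_n -> R) (v : 'I_k -> F) :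
    'rV[R]_n -> F :=
  fun y => \sum_(i < k) u i y *: v i.

(* A(R^n; F) *)
Definition A_space A F : fspace R :=
  @FSpace R ('rV[R]_n -> F)
    [set w | BUC w /\ forall e : R, 0 < e ->
      exists k (u : 'I_k -> 'rV[R]_n -> R) (v : 'I_k -> F),
        [/\ forall i, A (u i), forall i, felt F (v i) &
            (sup_norm (w - finite_sum u v)%R < e%:E)%E]]
    (@sup_norm F).

(* ||u||_q = limsup_{r -> oo} (|B_r|^-1 \int_{B_r} ||u(y)||_F^q dy)^(1/q) *)
Definition besicovitch_norm (q : R) F (u : 'rV[R]_n -> F) : \bar R :=
  (limf_esup (fun r : R => ((fine (leb n (eball r)))^-1)%:E *
     \int[leb n]_(y in eball r) (fnrm F (u y) `^ q)) +oo_R `^ q^-1)%E.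

(* B^q_A(R^n; F); as an [fspace] it stands for its quotient by the functions
   of seminorm 0. *)
Definition B_space A (q : R) F : fspace R :=
  @FSpace R ('rV[R]_n -> F)
    [set u | [/\ forall K, compact K -> Bochner (leb n) K q u,
      (besicovitch_norm q u < +oo)%E &
      forall e : R, 0 < e -> exists2 w, felt (A_space A F) w &
        (besicovitch_norm q (u - w)%R < e%:E)%E]]
    (@besicovitch_norm q F).

(* m is the value at u of the extension by continuity to B^1_A(R^n; F) of
   \sum_i u_i v_i |-> \sum_i M(u_i) v_i; it is the one used on every B^q_A,
   q >= 1, since ||.||_1 <= ||.||_q. *)
Definition is_mean_value A F (u : 'rV[R]_n -> F) (m : F) :=
  felt F m /\ forall e : R, 0 < e ->
  exists k (us : 'I_k -> 'rV[R]_n -> R) (vs : 'I_k -> F) (cs : 'I_k -> R),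
    [/\ forall i, A (us i), forall i, has_mean (us i) (cs i),
        forall i, felt F (vs i),
        (besicovitch_norm 1 (u - finite_sum us vs)%R < e%:E)%E &
        (fnrm F (m - \sum_(i < k) cs i *: vs i)%R < e%:E)%E].

Definition mean_value A F (u : 'rV[R]_n -> F) : F :=
  xget 0 [set m | is_mean_value A u m].

End algebra_with_mean_value.

Section sigma_convergence.
Context {R : realType} {n : nat}.
Context (A : set ('rV[R]_n -> R)) (Omega : set 'rV[R]_n) (I : set R).

(* \int_{G_0} \int_I M(w(x, ., z)) dz dx; for fixed x, the function w x is in
   B^1_A(R^n; L^1(I)), so that M(w x) is in L^1(I). *)
Definition mean_integral (w : 'rV[R]_n -> 'rV[R]_n -> R -> R) : R :=
  \int[leb n]_(x in Omega) \int[lebesgue_measure]_(z in I)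
    (mean_value A (w x : 'rV[R]_n -> Lp_space I 1) : R -> R) z.

(* Weak Sigma-convergence of v_(e k) to v0 as k -> oo, q being the conjugate
   exponent.  The elements f of L^q(G_0; A(R^n; L^q(I))) are represented by
   functions measurable in (x, y, z): each class has such a representative,
   and its trace f(x, x/eps) on G_eps is well defined almost everywhere. *)
Definition weak_sigma_cvg (q : R) (e : nat -> R)
    (v : R -> 'rV[R]_n * R -> R) (v0 : 'rV[R]_n -> 'rV[R]_n -> R -> R) :=
  forall f : 'rV[R]_n -> 'rV[R]_n -> R -> R,
    Bochner (leb n) Omega q (f : 'rV[R]_n -> A_space A (Lp_space I q)) ->
    measurable_fun ((Omega `*` setT) `*` I)
      (fun z : 'rV[R]_n * 'rV[R]_n * R => f z.1.1 z.1.2 z.2) ->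
    (e k)^-1 *
      \int[(leb n \x lebesgue_measure)%E]_(x in thin_cylinder Omega I (e k))
        (v (e k) x * f x.1 ((e k)^-1 *: x.1) ((e k)^-1 * x.2))
      @[k --> \oo] -->
    mean_integral (fun x y z => v0 x y z * f x y z).

End sigma_convergence.

Definition ordinary_sequence (R : realType) (E : nat -> R) :=
  (forall k, 0 < E k <= 1) /\ E k @[k --> \oo] --> 0.

(* P : L^p(D) -> L^p(G) is a continuous extension operator, with
   ||P v|| <= C ||v||; continuity makes P compatible with a.e. equality. *)
Definition extension_operator d (T : measurableType d) (R : realType)
    (mu : {measure set T -> \bar R}) (D G : set T) (p C : R)
    (P : (T -> R) -> (T -> R)) :=
  [/\ forall v, Lp mu D p v -> Lp mu G p (P v),
      forall v, Lp mu D p v -> P v = v %[ae mu in D],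
      forall v, Lp mu D p v ->
        (Lp_norm mu G p (P v) <= C%:E * Lp_norm mu D p v)%E &
      forall v, Lp mu D p v -> forall a : R, 0 < a ->
        exists2 b : R, 0 < b & forall w, Lp mu D p w ->
          (Lp_norm mu D p (w - v)%R < b%:E)%E ->
          (Lp_norm mu G p (P w - P v)%R < a%:E)%E].

(* Main.v *)
Require Import Defs.
From HB Require Import structures.
From mathcomp Require Import all_boot all_order all_algebra.
From mathcomp Require Import all_classical all_reals all_analysis.
From mathcomp Require Import measurable_realfun ring lra.

Set Implicit Arguments.
Unset Strict Implicit.
Unset Printing Implicit Defensive.

Import Order.TTheory GRing.Theory Num.Theory.
Import numFieldNormedType.Exports.

Local Open Scope classical_set_scope.
Local Open Scope ring_scope.

(** Outside the thin domain the extension [P u] is killed by the indicator of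
    the rescaled cell, so the left-hand side is the integral over the thin
    cylinder of [P u] against [1_J f].  It is therefore enough that [1_J f] be
    an admissible test function for weak Sigma-convergence, i.e. that
    multiplication by [1_J] sends A(R^n; C(cl I)) to A(R^n; L^q(I)).  The
    algebra A is closed under truncation, since [|u|] is a uniform limit of
    polynomials in [u]; on a grid [z_j] of mesh [r], the finite sum over [j] of
    [clamp ((z_j - h1 y) / r) * clamp ((h2 y - z_j) / r)] times the indicator
    of [z_j, z_j + r[ differs from [1_J (y, z)] only for [z] in a set of
    measure O(r), uniformly in [y]. *)

(** * Integrals of functions not known to be measurable *)

Section integral_without_measurability.
Context d (T : measurableType d) (R : realType).
Context (mu : {measure set T -> \bar R}).
Local Open Scope ereal_scope.
Import HBNNSimple.

(* No measurability is needed: the integral of a nonnegative function is a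
   supremum over the simple functions below it. *)
Lemma ae_le_integral (f g : T -> \bar R) :
  (forall x, 0 <= f x) -> (forall x, 0 <= g x) ->
  {ae mu, forall x, f x <= g x} ->
  \int[mu]_x f x <= \int[mu]_x g x.
Proof.
move=> f0 g0 [N [mN muN fgN]]; rewrite !ge0_integralTE//.
apply: ge_ereal_sup => _ [h /= hf <-].
have mCN : measurable (~` N) by exact: measurableC.
(* Setting [h] to 0 on the null set [N] keeps its integral and puts it below [g] everywhere. *)
pose k := proj_nnsfun h mCN.
have kE x : k x = (h x * \1_(~` N) x)%R by [].
have kg x : (k x)%:E <= g x.
  rewrite kE indicE; case: (boolP (x \in ~` N)) => [|_].
    rewrite inE mulr1 => Nx; apply: (le_trans (hf x)).
    by apply: contrapT => fgx; apply: Nx; apply: fgN.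
  by rewrite mulr0.
apply: ereal_sup_ubound; exists k => //.
rewrite -!integralT_nnsfun; apply: ge0_ae_eq_integral => //.
- exact/measurable_EFinP.
- exact/measurable_EFinP.
- by move=> x _; rewrite lee_fin fun_ge0.
- by move=> x _; rewrite lee_fin fun_ge0.
exists N; split=> // x; apply: contra_notP => Nx _; rewrite kE.
by rewrite indicE mem_set// mulr1.
Qed.

Lemma le_ge0_integral (f g : T -> \bar R) :
  (forall x, 0 <= f x) -> (forall x, f x <= g x) ->
  \int[mu]_x f x <= \int[mu]_x g x.
Proof.
move=> f0 fg; apply: ae_le_integral => // [x|]; last exact: aeW.
exact: le_trans (fg x).
Qed.

(** Dividing by [k] turns a simple function below [k f] into one below [f]. *)
Lemma ge0_le_integralZl (k : R) (f : T -> \bar R) :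
  (0 < k)%R -> (forall x, 0 <= f x) ->
  \int[mu]_x (k%:E * f x) <= k%:E * \int[mu]_x f x.
Proof.
move=> k0 f0; have kf0 x : 0 <= k%:E * f x by rewrite mule_ge0// lee_fin ltW.
rewrite !ge0_integralTE//.
apply: ge_ereal_sup => _ [h /= hf <-].
have kV0 : (0 <= k^-1)%R by rewrite invr_ge0 ltW.
pose g := scale_nnsfun h kV0.
have -> : sintegral mu h = k%:E * sintegral mu g.
  rewrite -sintegralrM; apply: eq_sintegral => x /=.
  by rewrite mulrA divff ?mul1r// gt_eqF.
rewrite lee_pmul2l//; apply: ereal_sup_ubound; exists g => //= x.
by rewrite EFinM lee_pdivrMl.
Qed.

(** Extension by 0 reduces both domains to the whole space; there the integrals of the positive and
    of the negative part each depend only on the function up to a null set. This serves both to pass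
    from the thin domain to the thin cylinder and to compare the mean values, whose measurability in
    [x] is not at hand. *)
Lemma ae_eq_Rintegral (D D' : set T) (f g : T -> R) :
  {ae mu, forall x, (f \_ D) x = (g \_ D') x} ->
  (\int[mu]_(x in D) f x = \int[mu]_(x in D') g x)%R.
Proof.
move=> fg; rewrite Rintegral_mkcond [RHS]Rintegral_mkcond.
congr fine; rewrite integralE [RHS]integralE.
have eq_ge0 (F G : T -> \bar R) : (forall x, 0 <= F x) -> (forall x, 0 <= G x) ->
    {ae mu, forall x, F x = G x} -> \int[mu]_x F x = \int[mu]_x G x.
  move=> F0 G0 FG; apply/eqP; rewrite eq_le; apply/andP; split;
    apply: ae_le_integral => //; by apply: filterS FG => x ->.
by congr (_ - _); apply: eq_ge0 => //; apply: filterS fg => x fgx;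
  rewrite ?funeposE ?funenegE fgx.
Qed.

End integral_without_measurability.

(** * Bounds for L^q norms *)

Section Lp_norm_bounds.
Context d (T : measurableType d) (R : realType).
Context (mu : {measure set T -> \bar R}).
Implicit Types (D B : set T) (v : T -> R) (q a b : R).
Local Open Scope ereal_scope.

Lemma ae_le_Lnorm_lty q (c : R) (f g : T -> \bar R) : (0 < q)%R -> (0 < c)%R ->
  {ae mu, forall x, `|f x| <= c%:E * `|g x|} ->
  'N[mu]_q%:E[g] < +oo -> 'N[mu]_q%:E[f] < +oo.
Proof.
move=> q0 c0 fg gy; have q1 : q != 0%R by rewrite gt_eqF.
have {}gy : \int[mu]_x (`|g x| `^ q) < +oo by rewrite -poweR_Lnorm// poweR_lty.
rewrite unlock poweR_lty//.
apply: (@le_lt_trans _ _ (\int[mu]_x ((c `^ q)%:E * (`|g x| `^ q)))).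
  apply: ae_le_integral => [x|x|]; first exact: poweR_ge0.
    by rewrite mule_ge0 ?lee_fin ?powR_ge0 ?poweR_ge0.
  apply: filterS fg => x fgx.
  rewrite -poweR_EFin -poweRM ?lee_fin ?abse_ge0 ?(ltW c0)//.
  apply: gt0_ler_poweR => //; rewrite ?in_itv/= ?leey ?abse_ge0// ?(ltW q0)//.
  by rewrite andbT mule_ge0// lee_fin ltW.
apply: le_lt_trans (ge0_le_integralZl _ _ _) _ => [|x|].
- by rewrite powR_gt0.
- exact: poweR_ge0.
- by rewrite lte_mul_pinfty// lee_fin powR_ge0.
Qed.

(** On [D] the power [|v|^q] lies below [a^q 1_D + b^q 1_B], whose integral is explicit. *)
Lemma Lp_norm_le D B v q a b : measurable D -> measurable B ->
  (0 < q)%R -> (0 <= a)%R -> (0 <= b)%R ->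
  (forall x, D x -> (`|v x| <= a)%R \/ B x /\ (`|v x| <= b)%R) ->
  Lp_norm mu D q v <= ((a `^ q)%:E * mu D + (b `^ q)%:E * mu B) `^ q^-1.
Proof.
move=> mD mB q0 a0 b0 vab.
have e0 x (E : set T) (c : R) : (0 <= c)%R -> 0 <= (c `^ q)%:E * (\1_E x : R)%:E.
  by move=> c0; rewrite mule_ge0// lee_fin ?powR_ge0.
have mind (E : set T) : measurable E -> measurable_fun setT (fun x => (\1_E x : R)%:E).
  by move=> mE; apply: measurableT_comp => //; exact: measurable_indic.
have mE (E : set T) (c : R) : measurable E -> 
    measurable_fun setT (fun x => (c `^ q)%:E * (\1_E x : R)%:E).
  move=> mE; apply: emeasurable_funM; first exact: measurable_cst.
  exact: mind.
suff : \int[mu]_x (`|(v \_ D) x|%:E `^ q) <=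
    (a `^ q)%:E * mu D + (b `^ q)%:E * mu B.
  rewrite /Lp_norm unlock => le; apply: gt0_ler_poweR.
  - by rewrite invr_ge0 ltW.
  - by rewrite in_itv/= leey andbT integral_ge0// => *; exact: poweR_ge0.
  - rewrite in_itv/= leey andbT adde_ge0// mule_ge0// ?lee_fin ?powR_ge0//.
  - exact: le.
have -> : (a `^ q)%:E * mu D + (b `^ q)%:E * mu B =
    \int[mu]_x ((a `^ q)%:E * (\1_D x)%:E + (b `^ q)%:E * (\1_B x)%:E).
  rewrite ge0_integralD//; [|by move=> *; exact: e0|exact: mE|
    by move=> *; exact: e0|exact: mE].
  rewrite !ge0_integralZl_EFin ?powR_ge0//; try exact: mind.
  by rewrite !integral_indic// !setIT.
apply: le_ge0_integral => x; first exact: poweR_ge0.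
rewrite poweR_EFin patchE; case: ifPn => [Dx|_]; last first.
  rewrite normr0 powR0 ?gt_eqF//.
  by rewrite adde_ge0// e0.
have powle c : (`|v x| <= c)%R -> (`|v x| `^ q <= c `^ q)%R.
  move=> vc; have c0 : (0 <= c)%R by exact: le_trans vc.
  by apply: ge0_ler_powR => //; exact: ltW.
have [vxa|[Bx vxb]] := vab x (set_mem Dx).
  rewrite [(\1_D x)%R]indicE Dx mule1 -[leLHS]adde0 leeD ?e0// lee_fin.
  exact: powle.
rewrite [(\1_B x)%R]indicE (mem_set Bx) mule1 -[leLHS]add0e leeD ?e0// lee_fin.
exact: powle.
Qed.

Lemma Lp_norm_le_sup D v q a : measurable D -> (0 < q)%R -> (0 <= a)%R ->
  (forall x, D x -> (`|v x| <= a)%R) ->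
  Lp_norm mu D q v <= a%:E * mu D `^ q^-1.
Proof.
move=> mD q0 a0 va.
apply: (@le_trans _ _ (((a `^ q)%:E * mu D + (a `^ q)%:E * mu set0) `^ q^-1)).
  by apply: Lp_norm_le => // x /va; left.
rewrite measure0 mule0 adde0 poweRM ?lee_fin ?powR_ge0//.
by rewrite poweR_EFin -powRrM divff ?gt_eqF// powRr1.
Qed.

(** The threshold [a] is fixed before [v] and [B]. Hence a function of [(y, z)] that is small in [z]
    off a small set depending on [y] has L^q norm in [z] small uniformly in [y]. *)
Lemma Lp_norm_small D q (e K : R) : measurable D -> mu D < +oo ->
  (0 < q)%R -> (0 < e)%R ->
  exists2 a : R, (0 < a)%R & forall v B, measurable B -> mu B <= a%:E ->
    (forall x, D x -> (`|v x| <= a)%R \/ B x /\ (`|v x| <= K)%R) ->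
    Lp_norm mu D q v < e%:E.
Proof.
move=> mD muD q0 e0.
have [m mE] : exists m : R, mu D = m%:E.
  by exists (fine (mu D)); rewrite fineK// ge0_fin_numE.
have m0 : (0 <= m)%R by rewrite -lee_fin -mE.
pose b : R := (Num.max K 0)%R; have b0 : (0 <= b)%R by rewrite le_max lexx orbT.
have bq := powR_ge0 b q; have eq0 : (0 < e `^ q)%R by rewrite powR_gt0.
(* This choice gives [c (m + b^q) < e^q]; the added 1 makes the denominator positive and the
   inequality strict. *)
pose c := (e `^ q / (m + b `^ q + 1))%R.
have c0 : (0 < c)%R by rewrite divr_gt0// ltr_wpDl// addr_ge0.
(* The first bound yields [mu B <= c], the second [a^q <= c]. *)
exists (Num.min c (c `^ q^-1))%R; first by rewrite lt_min c0 powR_gt0.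
set a : R := Num.min _ _ => v B mB muB vB.
have a0 : (0 <= a)%R by rewrite le_min (ltW c0) powR_ge0.
have aq : (a `^ q <= c)%R.
  have -> : c = ((c `^ q^-1) `^ q)%R.
    by rewrite -powRrM mulVf ?gt_eqF// powRr1// ltW.
  apply: ge0_ler_powR; rewrite ?nnegrE ?powR_ge0//; first exact: ltW.
  by rewrite /a ge_min lexx orbT.
apply: (@le_lt_trans _ _
    (((a `^ q)%:E * mu D + (b `^ q)%:E * mu B) `^ q^-1)).
  apply: Lp_norm_le => // x /vB [|[Bx vK]]; [by left|right; split=> //].
  by rewrite le_max vK.
have [s sE] : exists s : R, mu B = s%:E.
  by exists (fine (mu B)); rewrite fineK// ge0_fin_numE// (le_lt_trans muB)// ltry.
have s0 : (0 <= s)%R by rewrite -lee_fin -sE.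
have sc : (s <= c)%R.
  by move: muB; rewrite sE lee_fin /a le_min => /andP[].
rewrite mE sE -!EFinM -EFinD poweR_EFin lte_fin.
have -> : e = ((e `^ q) `^ q^-1)%R.
  by rewrite -powRrM divff ?gt_eqF// powRr1// ltW.
apply: gt0_ltr_powR; rewrite ?invr_gt0// ?nnegrE ?powR_ge0//.
  by rewrite addr_ge0// mulr_ge0// powR_ge0.
apply: (@le_lt_trans _ _ (c * (m + b `^ q))%R).
  by rewrite mulrDr lerD// ?ler_wpM2r// mulrC ler_wpM2r.
rewrite /c mulrAC ltr_pdivrMr; last by rewrite ltr_wpDl// addr_ge0.
by rewrite ltr_pM2l// ltrDl.
Qed.

End Lp_norm_bounds.

(** * Closure of the algebra under absolute value and truncation *)

Section lattice_operations.
Context (R : realType) (n : nat).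
Context (A : set ('rV[R]_n -> R)) (A_amv : algebra_with_mean_value A).
Implicit Types u v : 'rV[R]_n -> R.

(** The classical polynomial iteration for the square root of [t^2], as in the proof of the
    Stone-Weierstrass theorem. *)
Fixpoint abs_approx (k : nat) (t : R) : R :=
  if k is k'.+1 then
    abs_approx k' t + 2^-1 * (t * t - abs_approx k' t * abs_approx k' t)
  else 0.

(* With [s = |t| / 2], the error [e_k] satisfies [e_(k+1) <= (1 - s) e_k],
   hence [e_k (1 + k s) <= 2 s]. *)
Lemma abs_approxP k (t : R) : `|t| <= 1 ->
  [/\ 0 <= abs_approx k t, abs_approx k t <= `|t| &
      (`|t| - abs_approx k t) * (1 + k%:R * (`|t| / 2)) <= `|t|].
Proof.
move=> t1; have -> : abs_approx k t = abs_approx k `|t|.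
  elim: k => //= k <-; congr (_ + _ * (_ - _)).
  by rewrite -!expr2 real_normK// num_real.
move: t1 (normr_ge0 t); move: `|t| => {}t t1 t0.
elim: k => [|k [p0 pt IH]] /=; first by split; rewrite // mul0r addr0 subr0 mulr1.
move: (abs_approx k t) p0 pt IH => p p0 pt IH.
split; [nra|nra|].
rewrite -[k.+1%:R]natr1; have k0 : 0 <= k%:R :> R by [].
move: (k%:R : R) k0 IH => c c0 IH.
apply: le_trans IH.
have -> : t - (p + 2^-1 * (t * t - p * p)) = (t - p) * (1 - (t + p) / 2) by field.
rewrite -mulrA ler_wpM2l ?subr_ge0//.
apply: (@le_trans _ _ ((1 - t / 2) * (1 + (c + 1) * (t / 2)))); last nra.
by apply: ler_wpM2r; nra.
Qed.

(** Dropping the 1 in the weight [1 + K s / 2] and dividing by [s = |t|] gives a rate independent of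
    [t]; for [s = 0] the approximation is exact. *)
Lemma abs_approx_le k (t : R) : `|t| <= 1 ->
  `| `|t| - abs_approx k.+1 t| <= 2 / k.+1%:R.
Proof.
move=> /(abs_approxP k.+1)[]; move: (abs_approx _ t) (normr_ge0 t) => p.
have : 0 < k.+1%:R :> R by [].
move: (k.+1%:R : R) `|t| => K s K0 s0 p0 ps h.
rewrite ger0_norm ?subr_ge0// ler_pdivlMr//.
have [->|sn0] := eqVneq s 0; first by nra.
have {}s0 : 0 < s by rewrite lt_def sn0.
rewrite -(ler_pM2r s0); nra.
Qed.

Lemma amv_comp_abs_approx u k : A u -> A (fun x => abs_approx k (u x)).
Proof.
have [_ [Acst [AD [AM _]]]] := A_amv.
move=> Au; elim: k => [|k IH] /=; first exact: (Acst).
have -> : (fun x => abs_approx k (u x) +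
     2^-1 * (u x * u x - abs_approx k (u x) * abs_approx k (u x))) =
   (fun x => abs_approx k (u x) + (fun x => 2^-1 *
     (fun x => u x * u x + (fun x => -1 *
       (fun x => abs_approx k (u x) * abs_approx k (u x)) x) x) x) x).
  by apply/funext => x /=; rewrite mulN1r.
apply: (AD) => //; apply: (AM (fun=> _)); first exact: (Acst).
apply: (AD); first exact: (AM).
by apply: (AM (fun=> _)); [exact: (Acst)|exact: (AM)].
Qed.

Lemma amv_bounded u : A u -> exists2 K : R, 0 < K & forall x, `|u x| <= K.
Proof.
have [Abuc _] := A_amv; move=> /Abuc[[M [_ uM]] _].
exists (Num.max 1 (M + 1)); first by rewrite lt_max ltr01.
by move=> x; apply: uM => //; rewrite lt_max ltrDl ltr01 orbT.
Qed.

(** After division by a bound [K] of [u] the values lie in [-1, 1], where polynomials in [u]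
    converge uniformly to the absolute value; the algebra is uniformly closed. *)
Lemma amv_abs u : A u -> A (fun x => `|u x|).
Proof.
have [_ [Acst [_ [AM [Acl _]]]]] := A_amv.
move=> Au; have [K K0 uK] := amv_bounded Au.
have -> : (fun x => `|u x|) = (fun x => K * `|K^-1 * u x|).
  by apply/funext => x; rewrite normrM normfV (gtr0_norm K0) mulVKf// gt_eqF.
apply: (AM (fun=> _)); first exact: (Acst).
apply: (Acl) => e e0.
have [k ke] : exists k, 2 / k.+1%:R <= e.
  exists (Num.truncn (2 / e)); rewrite ler_pdivrMr// -ler_pdivrMl// mulrC.
  by apply/ltW/truncnS_gt.
exists (fun x => abs_approx k.+1 (K^-1 * u x)).
  by apply: (amv_comp_abs_approx _ (u := fun x => K^-1 * u x)); apply: (AM (fun=> _)).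
move=> x; apply: (le_trans _ ke); apply: abs_approx_le.
by rewrite normrM normfV (gtr0_norm K0) ler_pdivrMl// mulr1.
Qed.

(** Truncation of [t] to [0, 1], written with absolute values so that closure under [|.|]
    suffices. *)
Definition clamp (t : R) : R := (`|t| - `|t - 1| + 1) / 2.

Lemma clamp_eq0 t : t <= 0 -> clamp t = 0.
Proof.
move=> t0; rewrite /clamp ler0_norm// ler0_norm; last by lra.
by lra.
Qed.

Lemma clamp_eq1 t : 1 <= t -> clamp t = 1.
Proof.
by move=> t1; rewrite /clamp ger0_norm ?ger0_norm; lra.
Qed.

Lemma clamp_itv t : 0 <= clamp t <= 1.
Proof.
have [t0|t0] := leP t 0; first by rewrite clamp_eq0// lexx ler01.
have [t1|t1] := leP 1 t; first by rewrite clamp_eq1// lexx ler01.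
by rewrite /clamp ger0_norm ?ler0_norm; lra.
Qed.

Lemma amv_clamp u : A u -> A (fun x => clamp (u x)).
Proof.
have [_ [Acst [AD [AM [Acl _]]]]] := A_amv.
move=> Au.
have -> : (fun x => clamp (u x)) = (fun x => 2^-1 * (fun x => 1 +
   (fun x => (fun x => `|u x|) x + (fun x => -1 *
       (fun x => `|u x + -1|) x) x) x) x).
  by apply/funext => x /=; rewrite /clamp mulN1r mulrC addrC.
apply: (AM (fun=> _)); first exact: (Acst).
apply: (AD (fun=> _)); first exact: (Acst).
apply: (AD); first exact: amv_abs.
apply: (AM (fun=> _)); first exact: (Acst).
apply: (@amv_abs (fun x => u x + -1)).
by apply: (AD _ (fun=> _)).
Qed.

Lemma amv_affine u a b : A u -> A (fun x => a * u x + b).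
Proof.
have [_ [Acst [AD [AM _]]]] := A_amv => Au.
by apply: (AD (fun x => a * u x) (fun=> _)) => //; apply: (AM (fun=> _)).
Qed.

End lattice_operations.

(** * Open sets and continuous functions for the product sigma-algebra *)

Section borel_rV.
Context (R : realType) (n : nat).

(** The norm on row vectors is the maximum norm, so a ball is a finite intersection of coordinate
    strips. *)
Lemma measurable_ball_rV (c : 'rV[R]_n) (r : R) : 0 < r -> measurable (ball c r).
Proof.
move=> r0; have -> : ball c r =
    \bigcap_(i in [set: 'I_n]) ((fun x : 'rV[R]_n => x ord0 i) @^-1` ball (c ord0 i) r).
  apply/seteqP; split => [x [_ cx] i _|x cx]; first exact: cx.
  by split => // i j; rewrite (ord1 i); exact: cx.
apply: fin_bigcap_measurable => // i _; rewrite -[X in measurable X]setTI.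
by apply: measurable_rV_coord => //; exact: measurable_ball.
Qed.

(** An open set is the countable union of the balls with rational centre and radius [1 / (k + 1)]
    that it contains. *)
Lemma open_measurable_rV (U : set 'rV[R]_n) : open U -> measurable U.
Proof.
move=> oU.
pose B (q : 'rV[rat]_n) (k : nat) := ball (map_mx ratr q : 'rV[R]_n) k.+1%:R^-1.
have -> : U = \bigcup_(qk : 'rV[rat]_n * nat)
    (if `[< B qk.1 qk.2 `<=` U >] then B qk.1 qk.2 else set0).
  apply/seteqP; split=> [x Ux|x [[q k] _]]; last by case: asboolP => // BU /BU.
  have /nbhs_ballP[e /= e0 xeU] : nbhs x U by exact: open_nbhs_nbhs.
  (* Twice the radius is at most [e]: a ball of radius [r] containing [x] stays within distance [e]
     of [x]. *)
  pose k := Num.truncn (2 / e); pose r : R := k.+1%:R^-1.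
  have r0 : 0 < r by rewrite invr_gt0.
  have re : r + r <= e.
    rewrite -mulr2n -mulr_natl ler_pdivrMr// -ler_pdivrMl// mulrC.
    exact/ltW/truncnS_gt.
  have /choice[q qx] : forall i, exists q : rat, `|ratr q - x ord0 i| < r.
    move=> i; have /rat_in_itvoo[q] : x ord0 i - r < x ord0 i + r by lra.
    by rewrite in_itv/= => qr; exists q; rewrite ltr_norml; lra.
  exists (\row_i q i, k) => //=.
  have qx' : B (\row_i q i) k x.
    by split => // i j; rewrite (ord1 i) !mxE /ball/= qx.
  case: asboolP => // -[] y qy; apply: xeU.
  apply: (le_ball re); apply: ball_triangle qy.
  exact: ball_sym.
apply: countable_bigcupT_measurable => // -[q k] /=.
by case: asboolP => // _; exact: measurable_ball_rV.
Qed.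

Lemma continuous_measurable_rV (u : 'rV[R]_n -> R) :
  continuous u -> measurable_fun setT u.
Proof.
move=> /continuousP cu; apply: (measurability _ (RGenOpens.measurableE R)).
move=> _ [_ [a [b ->] <-]]; rewrite setTI; apply: open_measurable_rV.
exact/cu/interval_open.
Qed.

End borel_rV.

(** * Approximation of the indicator of the cell by finite sums *)

Section cell_multiplier.
Context (R : realType) (n : nat).
Context (A : set ('rV[R]_n -> R)) (A_amv : algebra_with_mean_value A).
Context (h1 h2 : 'rV[R]_n -> R) (h1_A : A h1) (h2_A : A h2).
Local Notation I := (height_itv h1 h2).
Local Notation J := (reference_cell h1 h2).
Local Notation lambda := (@lebesgue_measure R).

Lemma amv_unif_continuous u (e : R) : A u -> 0 < e ->
  exists2 r : R, 0 < r & forall x y, ball x r y -> `|u x - u y| < e.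
Proof.
have [Abuc _] := A_amv; move=> /Abuc[_ /unif_continuousP cu] e0.
have [r /= r0 ru] := cu e e0.
by exists r => // x y xy; exact: (ru (x, y)).
Qed.

Lemma amv_continuous u : A u -> continuous u.
Proof.
move=> Au x; apply/(@cvgrPdist_lt _ _ _ (nbhs x)) => e e0.
have [r r0 ur] := amv_unif_continuous Au e0.
by apply/nbhs_ballP; exists r => // y xy; exact: ur.
Qed.

Lemma amv_measurable u : A u -> measurable_fun setT u.
Proof. by move=> Au; apply: continuous_measurable_rV; exact: amv_continuous. Qed.

Lemma measurable_height_itv : measurable I.
Proof. exact: measurable_itv. Qed.

Lemma height_itv_lty : (lambda I < +oo)%E.
Proof. by rewrite lebesgue_measure_itv/=; case: ifP; rewrite // -EFinB ltry. Qed.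

Lemma compact_closure_height_itv : compact (closure I).
Proof.
apply: (@subclosed_compact _ _ `[inf (range h1), sup (range h2)]).
- exact: closed_closure.
- exact: segment_compact.
- have /closure_id -> : closed (`[inf (range h1), sup (range h2)] : set R).
    exact: itv_closed.
  by apply: closureS; exact: subset_itv_oo_cc.
Qed.

Lemma inf_le_height x : inf (range h1) <= h1 x.
Proof.
have [K _ hK] := amv_bounded A_amv h1_A; apply: ge_inf; last by exists x.
by exists (- K) => _ [y _ <-]; have := hK y; rewrite ler_norml => /andP[].
Qed.

Lemma height_le_sup x : h2 x <= sup (range h2).
Proof.
have [K _ hK] := amv_bounded A_amv h2_A; apply: ub_le_sup; last by exists x.
by exists K => _ [y _ <-]; have := hK y; rewrite ler_norml => /andP[].
Qed.

Lemma lebesgue_measure_segment_le (a b e : R) : 0 <= e -> b - a <= e ->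
  (lambda `[a, b] <= e%:E)%E.
Proof.
move=> e0 bae; rewrite lebesgue_measure_itv/=.
by case: ifP => _; rewrite ?lee_fin// -EFinB lee_fin.
Qed.

(** The exceptional set [B] surrounds the two heights [h1 y] and [h2 y]. It moves with [y], while
    the bound on its measure does not; the bounds 0 and 1 on the sum hold on [B] as well. *)
Lemma cell_indicator_approx (e : R) : 0 < e ->
  exists N (a : 'I_N -> 'rV[R]_n -> R) (Q : 'I_N -> set R),
    [/\ forall j, A (a j), forall j, measurable (Q j) & forall y, exists B,
      [/\ measurable B, (lambda B <= e%:E)%E & forall z, I z ->
        let S := \sum_j a j y * \1_(Q j) z in
        0 <= S <= 1 /\ (B z \/ S = \1_J (y, z))]].
Proof.
move=> e0; pose r := e / 8; have r0 : 0 < r by rewrite divr_gt0.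
pose m := inf (range h1); pose t (j : nat) : R := m + j%:R * r.
(* With this many cells of length [r] starting at [m], the grid covers the whole of [I]. *)
pose N := (Num.truncn ((sup (range h2) - m) / r)).+1.
pose b (j : nat) y := clamp (r^-1 * (t j - h1 y)) * clamp (r^-1 * (h2 y - t j)).
exists N, (fun j => b j), (fun j => `[t j, t j.+1[%classic); split.
- move=> j; have [_ [_ [_ [AM _]]]] := A_amv; apply: (AM).
    apply: (amv_clamp A_amv (u := fun y => r^-1 * (t j - h1 y))).
    rewrite (_ : (fun y => _) = (fun y => - r^-1 * h1 y + r^-1 * t j)).
      exact: (amv_affine A_amv).
    by apply/funext => y; ring.
  apply: (amv_clamp A_amv (u := fun y => r^-1 * (h2 y - t j))).
  rewrite (_ : (fun y => _) = (fun y => r^-1 * h2 y + - r^-1 * t j)).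
    exact: (amv_affine A_amv).
  by apply/funext => y; ring.
- by move=> j; exact: measurable_itv.
move=> y; exists (`[h1 y, h1 y + 2 * r] `|` `[h2 y - r, h2 y + r]); split.
- by apply: measurableU; exact: measurable_itv.
- apply: (@le_trans _ _ (lambda `[h1 y, (h1 y + 2 * r)%R] +
      lambda `[(h2 y - r)%R, (h2 y + r)%R])%E).
    by apply: measureU2; exact: measurable_itv.
  have -> : e%:E = ((2 * r)%:E + (6 * r)%:E)%E by rewrite -EFinD /r; congr EFin; field.
  by apply: leeD; apply: lebesgue_measure_segment_le; lra.
move=> z Iz S; have /andP[mz zM] : m < z < sup (range h2).
  by move: Iz; rewrite /height_itv/= in_itv.
have zm0 : 0 <= (z - m) / r by apply: divr_ge0; rewrite ?subr_ge0 ltW.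
have jN : (Num.truncn ((z - m) / r) < N)%N.
  by rewrite ltnS le_truncn// ler_pM2r ?invr_gt0// lerD2r ltW.
pose j := Ordinal jN.
have tE (k : nat) : (z \in `[t k, t k.+1[) = (k%:R <= (z - m) / r < k.+1%:R).
  by rewrite in_itv/= ler_pdivlMr// ltr_pdivrMr// lerBrDl ltrBlDl.
have tS k : t k.+1 = t k + r by rewrite /t -[k.+1%:R]natr1 mulrDl mul1r addrA.
have tz : t j <= z < t j + r.
  have : z \in `[t j, t j.+1[ by rewrite tE truncn_itv.
  by rewrite in_itv tS.
(* The grid cells are disjoint, so only the cell containing [z] contributes. *)
have SE : S = b j y.
  rewrite /S (bigD1 j)//= big1 ?addr0 => [|k kj].
    by rewrite indicE mem_set ?mulr1//= tE truncn_itv.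
  rewrite indicE memNset ?mulr0//= tE => /truncn_def zk.
  by move: kj; rewrite -val_eqE/= zk eqxx.
have /andP[c10 c11] := clamp_itv (r^-1 * (t j - h1 y)).
have /andP[c20 c21] := clamp_itv (r^-1 * (h2 y - t j)).
rewrite SE /b; split; first by rewrite mulr_ge0// mulr_ile1.
rewrite indicE; case: (boolP ((y, z) \in J)).
  rewrite inE /reference_cell/= => /andP[zh1 zh2].
  have [zh1r|zh1r] := leP z (h1 y + 2 * r).
    by left; left; rewrite /= in_itv/=; apply/andP; split; lra.
  have [zh2r|zh2r] := leP (h2 y - r) z.
    by left; right; rewrite /= in_itv/=; apply/andP; split; lra.
  (* Here [z - r < t j <= z], so [t j] is at least [r] away from both heights and both factors are
     saturated. *)
  right; rewrite !clamp_eq1 ?mulr1//.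
    by rewrite mulrC ler_pdivlMr// mul1r; lra.
  by rewrite mulrC ler_pdivlMr// mul1r; lra.
move=> /negP zJ.
have [zh1|zh1] := leP z (h1 y).
  right; rewrite clamp_eq0 ?mul0r//.
  by rewrite pmulr_rle0 ?invr_gt0//; lra.
have zh2 : h2 y <= z.
  by rewrite leNgt; apply/negP => zh2; apply: zJ; rewrite inE /reference_cell/= zh1.
have [zh2r|zh2r] := leP z (h2 y + r).
  by left; right; rewrite /= in_itv/=; apply/andP; split; lra.
(* Since [t j > z - r], the grid point is still above [h2 y]. *)
right; rewrite (@clamp_eq0 _ (_ * (h2 y - _))) ?mulr0//.
by rewrite pmulr_rle0 ?invr_gt0//; lra.
Qed.

End cell_multiplier.

(** * Multiplication by the cell indicator, from continuous to L^q values *)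

Lemma le_C_norm (R : realType) (K : set R) (w : C_space K) z :
  K z -> ((`|w z|)%:E <= fnrm (C_space K) w)%E.
Proof.
move=> Kz; apply: ereal_sup_ubound; exists z => //.
by rewrite patchE mem_set.
Qed.

Lemma le_sup_norm (R : realType) n (F : fspace R) (w : 'rV[R]_n -> F) y :
  (fnrm F (w y) <= sup_norm w)%E.
Proof. by apply: ereal_sup_ubound; exists y. Qed.

(** Lets the product of two finite sums, indexed by pairs, be read as a sum over an ordinal. *)
Lemma finite_sum_enum (R : realType) n (F : fspace R) (T : finType)
    (u : T -> 'rV[R]_n -> R) (v : T -> F) :
  finite_sum (u \o @enum_val T T) (v \o @enum_val T T) = fun y => \sum_t u t y *: v t.
Proof.
apply/funext => y; rewrite /finite_sum.
rewrite [RHS](reindex (@enum_val T T))//=.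
by apply: onW_bij; exact: enum_val_bij.
Qed.

Section cell_multiplier_space.
Context (R : realType) (n : nat).
Context (A : set ('rV[R]_n -> R)) (A_amv : algebra_with_mean_value A).
Context (h1 h2 : 'rV[R]_n -> R) (h1_A : A h1) (h2_A : A h2).
Local Notation I := (height_itv h1 h2).
Local Notation J := (reference_cell h1 h2).
Local Notation lambda := (@lebesgue_measure R).

Definition cell_mul (v : 'rV[R]_n -> R -> R) : 'rV[R]_n -> R -> R :=
  fun y z => \1_J (y, z) * v y z.

Lemma cell_indic_norm_le1 y z : `|\1_J (y, z) : R| <= 1.
Proof. by rewrite indicE; case: (_ \in _); rewrite ?normr1 ?normr0. Qed.

Lemma Lp_height_itv (q a : R) (w : R -> R) : 0 < q -> 0 <= a ->
  measurable_fun I w -> (forall z, I z -> `|w z| <= a) ->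
  Lp lambda I q w.
Proof.
move=> q0 a0 mw wa; have mI := measurable_height_itv h1 h2.
rewrite /Lp/= inE; apply/andP; split; rewrite inE/=.
  exact/(measurable_restrictT _ mI).
apply: (le_lt_trans (Lp_norm_le_sup lambda mI q0 a0 wa)).
rewrite lte_mul_pinfty ?lee_fin ?poweR_lty//.
exact: height_itv_lty.
Qed.

Lemma closure_height_measurable (w : R -> R^o) :
  {within closure I, continuous w} -> measurable_fun I w.
Proof.
move=> cw; have mK : measurable (closure I).
  by apply: closed_measurable; exact: closed_closure.
apply: (measurable_funS mK); first exact: subset_closure.
exact: subspace_continuous_measurable_fun.
Qed.

Lemma closure_height_bounded (w : R -> R^o) :
  {within closure I, continuous w} ->
  exists2 M : R, 0 < M & forall z, closure I z -> `|w z| <= M.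
Proof.
move=> cw; have := continuous_compact cw (@compact_closure_height_itv _ _ h1 h2).
move=> /compact_bounded[M [_ wM]]; exists (Num.max 1 (M + 1)).
  by rewrite lt_max ltr01.
move=> z Kz; apply: (wM _ _ (w z)); last by exists z.
by rewrite lt_max ltrDl ltr01 orbT.
Qed.

Lemma A_C_bounded (v : 'rV[R]_n -> C_space (closure I)) :
  (sup_norm v < +oo)%E ->
  exists2 M : R, 0 < M & forall y z, closure I z -> `|v y z| <= M.
Proof.
move=> vy.
have vM y z : closure I z -> ((`|v y z|)%:E <= sup_norm v)%E.
  by move=> Kz; apply: (le_trans (le_C_norm _ Kz)); exact: le_sup_norm.
exists (Num.max 1 (fine (sup_norm v))); first by rewrite lt_max ltr01.
move=> y z Kz; rewrite le_max; apply/orP; right.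
by rewrite -lee_fin fineK ?vM// ge0_fin_numE// (le_trans _ (vM y z Kz)).
Qed.

Lemma measurable_reference_cell : measurable J.
Proof.
have mh (h : 'rV[R]_n -> R) : A h ->
    measurable_fun setT (fun x : 'rV[R]_n * R => h x.1).
  move=> Ah; apply: (measurableT_comp (f := h)) => //.
  exact: (amv_measurable A_amv).
have mlt (f g : 'rV[R]_n * R -> R) : measurable_fun setT f ->
    measurable_fun setT g -> measurable [set x | f x < g x].
  move=> mf mg; rewrite -[X in measurable X]setTI.
  by have /(_ measurableT [set true]) := measurable_fun_ltr mf mg; apply.
rewrite (_ : J = [set x | h1 x.1 < x.2] `&` [set x | x.2 < h2 x.1]).
  by apply: measurableI; apply: mlt => //; exact: mh.
by apply/seteqP; split=> x /=; rewrite /reference_cell/=; [move=> /andP|move=> [-> ->]].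
Qed.

Lemma measurable_cell_section y : measurable_fun setT (fun z => \1_J (y, z) : R).
Proof.
apply: (@measurableT_comp _ _ _ _ _ _ (\1_J : 'rV[R]_n * R -> R) _ (pair y)) => //.
by apply: measurable_indic; exact: measurable_reference_cell.
Qed.

Lemma Lp_cell_mul (q : R) (v : 'rV[R]_n -> R -> R^o) y : 0 < q ->
  {within closure I, continuous (v y)} -> Lp lambda I q (cell_mul v y).
Proof.
move=> q0 cv; have [M M0 vM] := closure_height_bounded cv.
apply: (@Lp_height_itv _ M) => //; first exact: ltW.
  apply: measurable_funM; last exact: closure_height_measurable.
  by apply: measurable_funTS; exact: measurable_cell_section.
move=> z Iz; rewrite normrM -[leRHS]mul1r.
by apply: ler_pM => //; [exact: cell_indic_norm_le1|apply/vM/subset_closure].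
Qed.

(** Both ends of the vertical slice move by less than [d], so a height farther than [d] from them
    stays on the same side. *)
Lemma cell_indic_stable y y' z (d : R) :
  `|h1 y - h1 y'| < d -> `|h2 y - h2 y'| < d ->
  ~ (`[h1 y - d, h1 y + d] `|` `[h2 y - d, h2 y + d]) z ->
  \1_J (y, z) = \1_J (y', z) :> R.
Proof.
rewrite !ltr_norml => /andP[h1l h1r] /andP[h2l h2r] /= /not_orP[].
rewrite !in_itv/= => /negP zh1 /negP zh2.
rewrite !indicE; congr ((nat_of_bool _)%:R); apply/idP/idP;
  rewrite !inE /reference_cell/= => /andP[z1 z2].
- have {}z1 : h1 y + d < z.
    by rewrite ltNge; apply: contra zh1 => ->; rewrite andbT; lra.
  have {}z2 : z < h2 y - d.
    by rewrite ltNge; apply: contra zh2 => ->; lra.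
  by apply/andP; split; lra.
- have {}z1 : h1 y + d < z.
    by rewrite ltNge; apply: contra zh1 => ->; rewrite andbT; lra.
  have {}z2 : z < h2 y - d.
    by rewrite ltNge; apply: contra zh2 => ->; lra.
  by apply/andP; split; lra.
Qed.

(** The indicator jumps in [z], but when [y] moves a little it changes only in two thin bands. This
    is small in L^q(I) though not in the sup norm, hence the change of target space. *)
Lemma BUC_cell_mul (q : R) (v : 'rV[R]_n -> C_space (closure I)) : 0 < q ->
  BUC v -> BUC (cell_mul v : 'rV[R]_n -> Lp_space I q).
Proof.
move=> q0 [vC vy vu]; have mI := measurable_height_itv h1 h2.
have lI := @height_itv_lty _ _ h1 h2.
have [M M0 vM] := A_C_bounded vy; split.
- by move=> y; apply: Lp_cell_mul => //; exact: vC.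
- apply: (@le_lt_trans _ _ (M%:E * lambda I `^ q^-1)%E); last first.
    by rewrite lte_mul_pinfty ?lee_fin ?poweR_lty// ltW.
  apply: ge_ereal_sup => _ [y _ <-]; apply: Lp_norm_le_sup => //; first exact: ltW.
  move=> z Iz; rewrite normrM -[leRHS]mul1r.
  by apply: ler_pM => //; [exact: cell_indic_norm_le1|apply/vM/subset_closure].
move=> e e0; have [a a0 small] := Lp_norm_small (mu := lambda) (M + M) mI lI q0 e0.
have a40 : 0 < a / 4 by rewrite divr_gt0.
have [r1 r10 vr] := vu a a0.
have [r2 r20 h1r] := amv_unif_continuous A_amv h1_A a40.
have [r3 r30 h2r] := amv_unif_continuous A_amv h2_A a40.
pose r := Num.min r1 (Num.min r2 r3).
exists r; first by rewrite !lt_min r10 r20.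
move=> y y' yy'.
have ry1 : ball y r1 y' by apply: le_ball yy'; rewrite ge_min lexx.
have ry2 : ball y r2 y' by apply: le_ball yy'; rewrite !ge_min lexx orbT.
have ry3 : ball y r3 y' by apply: le_ball yy'; rewrite !ge_min lexx !orbT.
(* Each band has length [a / 2], for a total of [a]; on them the crude bound [M + M] is enough. *)
apply: (small _ (`[h1 y - a / 4, h1 y + a / 4] `|`
                 `[h2 y - a / 4, h2 y + a / 4])).
- by apply: measurableU; exact: measurable_itv.
- apply: (@le_trans _ _ (lambda `[(h1 y - a / 4)%R, (h1 y + a / 4)%R] +
      lambda `[(h2 y - a / 4)%R, (h2 y + a / 4)%R])%E).
    by apply: measureU2; exact: measurable_itv.
  have -> : a%:E = ((a / 2)%:E + (a / 2)%:E)%E by rewrite -EFinD; congr EFin; field.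
  by apply: leeD; apply: lebesgue_measure_segment_le; lra.
move=> z Iz; have Kz : closure I z by exact: subset_closure.
have -> : (cell_mul v y - cell_mul v y') z =
  \1_J (y, z) * v y z - \1_J (y', z) * v y' z by [].
have [B|B] := pselect ((`[h1 y - a / 4, h1 y + a / 4] `|`
                 `[h2 y - a / 4, h2 y + a / 4]) z).
  right; split=> //; apply: (le_trans (ler_normB _ _)).
  apply: lerD; rewrite normrM -[leRHS]mul1r; apply: ler_pM => //;
    by [exact: cell_indic_norm_le1|exact: vM].
left; rewrite -(cell_indic_stable (h1r _ _ ry2) (h2r _ _ ry3) B) -mulrBr normrM.
rewrite -[leRHS]mul1r; apply: ler_pM => //; first exact: cell_indic_norm_le1.
rewrite -lee_fin; apply: le_trans (ltW (vr _ _ ry1)).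
exact: (le_C_norm (v y - v y')).
Qed.

(** Multiplying an approximation of [v] by [u_i w_i] with one of the indicator by [b_j 1_(Q j)]
    gives a finite sum with coefficients [u_i b_j] in the algebra and vectors [w_i 1_(Q j)] in
    L^q(I). *)
Lemma A_space_cell_mul (q : R) (v : 'rV[R]_n -> C_space (closure I)) : 0 < q ->
  felt (A_space A (C_space (closure I))) v ->
  felt (A_space A (Lp_space I q)) (cell_mul v).
Proof.
move=> q0 [vBUC vA]; split; first exact: BUC_cell_mul.
have mI := measurable_height_itv h1 h2; have lI := @height_itv_lty _ _ h1 h2.
have [vC vy _] := vBUC; have [M M0 vM] := A_C_bounded vy.
(* A supremum over [y] only preserves large inequalities; halving [e] restores the strict one. *)
move=> e e0; have e20 : 0 < e / 2 by rewrite divr_gt0.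
have [a a0 small] := Lp_norm_small (mu := lambda) (M + (M + 1)) mI lI q0 e20.
(* The cap at 1 gives [|V| <= M + 1], whence the bound [M + (M + 1)] on the exceptional set. *)
pose d : R := Num.min a 1; have d0 : 0 < d by rewrite lt_min a0 ltr01.
have [k [u [w [uA wC vuw]]]] := vA d d0.
have [N [b [Q [bA mQ bQ]]]] := cell_indicator_approx A_amv h1_A h2_A a0.
pose us (ij : 'I_k * 'I_N) y := u ij.1 y * b ij.2 y.
pose ws (ij : 'I_k * 'I_N) : Lp_space I q := fun z => w ij.1 z * \1_(Q ij.2) z.
have [_ [_ [_ [AM _]]]] := A_amv.
exists #|{: 'I_k * 'I_N}|, (us \o enum_val), (ws \o enum_val); split.
- by move=> i; apply: (AM).
- move=> i /=; have [K K0 wK] := closure_height_bounded (wC (enum_val i).1).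
  apply: (@Lp_height_itv _ K) => //; first exact: ltW.
    apply: measurable_funM; first by apply: closure_height_measurable; exact: wC.
    by apply: measurable_funTS; exact: measurable_indic.
  move=> z Iz; rewrite normrM -[leRHS]mulr1; apply: ler_pM => //.
    exact/wK/subset_closure.
  by rewrite indicE; case: (_ \in _); rewrite ?normr1 ?normr0.
rewrite finite_sum_enum; apply: (@le_lt_trans _ _ (e / 2)%:E); last first.
  by rewrite lte_fin; lra.
apply: ge_ereal_sup => _ [y _ <-]; apply: ltW.
have [B [mB muB yB]] := bQ y; apply: (small _ B) => // z Iz.
have Kz : closure I z by exact: subset_closure.
have [/andP[S0 S1] SJ] := yB z Iz.
pose S := \sum_j b j y * \1_(Q j) z; rewrite -/S in S0 S1 SJ.
pose V := finite_sum u w y z.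
have -> : (cell_mul v - (fun y => \sum_ij us ij y *: ws ij)) y z =
    \1_J (y, z) * v y z - V * S.
  congr (_ - _); rewrite fct_sumE.
  rewrite /V /finite_sum fct_sumE big_distrlr/= pair_big/=.
  by apply: eq_bigr => -[i j] _ /=; rewrite /us /ws/=; exact: mulrACA.
have Vd : `|v y z - V| <= d.
  rewrite -lee_fin; apply: le_trans (ltW vuw).
  apply: le_trans (le_sup_norm _ y); exact: (le_C_norm _ Kz).
have VM : `|V| <= M + 1.
  have -> : V = v y z - (v y z - V) by ring.
  apply: (le_trans (ler_normB _ _)); apply: lerD; first exact: vM.
  by apply: (le_trans Vd); rewrite /d ge_min lexx orbT.
have J1 := cell_indic_norm_le1 y z.
have [Bz|SE] := SJ; [right; split=> //|left].
  apply: (le_trans (ler_normB _ _)); apply: lerD; rewrite normrM.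
    by rewrite -[leRHS]mul1r; apply: ler_pM => //; exact: vM.
  by rewrite -[leRHS]mulr1; apply: ler_pM => //; rewrite ger0_norm.
rewrite SE [V * _]mulrC -mulrBr normrM -[leRHS]mul1r; apply: ler_pM => //.
by apply: (le_trans Vd); rewrite /d ge_min lexx.
Qed.

End cell_multiplier_space.

(** * The multiplied function as an admissible test function *)

Lemma C_norm_ge0 (R : realType) (K : set R) (w : C_space K) :
  (0 <= fnrm (C_space K) w)%E.
Proof.
apply: (@le_trans _ _ (`|(w \_ K) 0|)%:E); first by rewrite lee_fin.
by apply: ereal_sup_ubound; exists 0.
Qed.

Lemma cvg_of_le_cvge0 (R : realType) (a : (\bar R)^nat) (b : R^nat) (l : R) :
  (forall k, ((`|l - b k|)%:E <= a k)%E) -> a @ \oo --> 0%E -> b @ \oo --> l.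
Proof.
move=> ba a0; have : (`|l - b k|)%:E @[k --> \oo] --> 0%E.
  apply: (squeeze_cvge _ _ a0); last exact: cvg_cst.
  by apply: nearW => k; rewrite ba andbT lee_fin.
move=> /fine_cvgP[_] /=; move=> /norm_cvg0P lb.
have -> : b = cst l \- (fun k => l - b k) by apply/funext => k /=; rewrite subKr.
by rewrite -[l in X in _ --> X]subr0; apply: cvgB; [exact: cvg_cst|exact: lb].
Qed.

Section cell_multiplier_Bochner.
Context (R : realType) (n : nat).
Context (A : set ('rV[R]_n -> R)) (A_amv : algebra_with_mean_value A).
Context (h1 h2 : 'rV[R]_n -> R) (h1_A : A h1) (h2_A : A h2).
Local Notation I := (height_itv h1 h2).
Local Notation J := (reference_cell h1 h2).
Local Notation lambda := (@lebesgue_measure R).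
Local Notation AC := (A_space A (C_space (closure I))).

(** On the product with [I], [v] is a uniform limit of sums of products [u_i(y) w_i(z)]. *)
Lemma measurable_A_C_space (v : AC) : felt AC v ->
  measurable_fun (setT `*` I) (fun yz : 'rV[R]_n * R => v yz.1 yz.2).
Proof.
move=> [_ vA]; have mI := measurable_height_itv h1 h2.
have mTI : measurable ([set: 'rV[R]_n] `*` I) by exact: measurableX.
have /choice[g gP] : forall k : nat, exists g : 'rV[R]_n * R -> R,
    measurable_fun (setT `*` I) g /\
    forall y z, I z -> `|v y z - g (y, z)| <= k.+1%:R^-1.
  move=> k; have k0 : 0 < k.+1%:R^-1 :> R by rewrite invr_gt0.
  have [m [u [w [uA wC vuw]]]] := vA _ k0.
  exists (fun yz => finite_sum u w yz.1 yz.2); split; last first.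
    move=> y z Iz; rewrite -lee_fin; apply: le_trans (ltW vuw).
    apply: le_trans (le_sup_norm _ y).
    exact: (le_C_norm _ (subset_closure Iz)).
  have -> : (fun yz : 'rV[R]_n * R => finite_sum u w yz.1 yz.2) =
      (fun yz => \sum_i u i yz.1 * w i yz.2).
    by apply/funext => yz; rewrite /finite_sum fct_sumE.
  apply: measurable_sum => i; apply: measurable_funM.
    apply: measurable_funTS; apply: (measurableT_comp (f := u i)) => //.
    exact: (amv_measurable A_amv).
  apply: (@measurable_comp _ _ _ _ _ _ I) => //.
  - by move=> _ [yz [_ Iz] <-].
  - by apply: closure_height_measurable; exact: wC.
  - exact: measurable_funTS.
apply: (@measurable_fun_cvg _ _ _ _ g) => [k|[y z] [_ Iz]].
  by have [] := gP k.
apply: (@cvg_of_le_cvge0 _ (fun k => (k.+1%:R^-1)%:E)).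
  by move=> k; rewrite lee_fin; have [_] := gP k; apply.
by apply: cvg_EFin; [exact: nearW|exact: cvg_harmonic].
Qed.

(** Over each of the finitely many level sets in [x] the function depends on [(y, z)] alone. *)
Lemma measurable_simple_on_A_C (Omega : set 'rV[R]_n) (s : 'rV[R]_n -> AC) :
  simple_on Omega s ->
  measurable_fun ((Omega `*` setT) `*` I)
    (fun z : 'rV[R]_n * 'rV[R]_n * R => s z.1.1 z.1.2 z.2).
Proof.
move=> [fs ms sA] _ B mB; have mI := measurable_height_itv h1 h2.
pose D v := ((Omega `&` s @^-1` [set v]) `*` [set: 'rV[R]_n]) `*` I.
rewrite [X in measurable X](_ : _ = \bigcup_(v in s @` Omega)
    (D v `&` (fun z => v z.1.2 z.2) @^-1` B)); last first.
  apply/seteqP; split=> [[[x y] z] [[[Ox _] Iz] Bs]|[[x y] z]].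
    by exists (s x); [exists x|].
  by move=> [v _ [[[[Ox sxv] _] Iz] Bv]]; split=> //=; rewrite sxv.
apply: fin_bigcup_measurable => // _ [x Ox <-].
have mD : measurable (D (s x)) by do 2![apply: measurableX => //].
suff : measurable_fun (D (s x))
    (fun z : 'rV[R]_n * 'rV[R]_n * R => s x z.1.2 z.2) by exact.
apply: (@measurable_comp _ _ _ _ _ _ (setT `*` I)
  (fun yz : 'rV[R]_n * R => s x yz.1 yz.2) _
  (fun z : 'rV[R]_n * 'rV[R]_n * R => (z.1.2, z.2))).
- exact: measurableX.
- by move=> _ [[[x' y] z] [[_ _] Iz] <-].
- by apply: measurable_A_C_space; exact: sA.
apply: measurable_funTS; apply: measurable_fun_pair => //.
exact: measurableT_comp.
Qed.

Lemma sup_norm_cell_mul_le (q : R) : 0 < q ->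
  exists2 c : R, 0 < c & forall w : 'rV[R]_n -> C_space (closure I),
    (sup_norm (cell_mul h1 h2 w : 'rV[R]_n -> Lp_space I q) <=
     c%:E * sup_norm w)%E.
Proof.
move=> q0; have mI := measurable_height_itv h1 h2.
have lI := @height_itv_lty _ _ h1 h2.
have cfin : (lambda I `^ q^-1)%E \is a fin_num.
  by rewrite ge0_fin_numE ?poweR_ge0// poweR_lty.
pose c := fine (lambda I `^ q^-1)%E; have c0 : 0 <= c by rewrite fine_ge0// poweR_ge0.
(* Adding 1 keeps the constant positive even when [I] is empty. *)
exists (c + 1); first by rewrite ltr_wpDl.
move=> w; have w0 : (0 <= sup_norm w)%E.
  by apply: le_trans (le_sup_norm w 0); exact: C_norm_ge0.
have [->|] := eqVneq (sup_norm w) +oo%E.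
  by rewrite gt0_muley ?leey// lte_fin ltr_wpDl.
rewrite -ltey => wy; apply: ge_ereal_sup => _ [y _ <-].
have wE : sup_norm w = (fine (sup_norm w))%:E by rewrite fineK// ge0_fin_numE.
apply: (@le_trans _ _ ((fine (sup_norm w))%:E * lambda I `^ q^-1)%E).
  apply: Lp_norm_le_sup => //; first exact: fine_ge0.
  move=> z Iz; rewrite /cell_mul normrM -[leRHS]mul1r.
  apply: ler_pM => //; first exact: cell_indic_norm_le1.
  rewrite -lee_fin -wE; apply: (le_trans (le_C_norm _ (subset_closure Iz))).
  exact: le_sup_norm.
by rewrite -wE muleC lee_wpmul2r// -[leLHS]fineK// lee_fin lerDl.
Qed.

Lemma cell_mulB (v w : 'rV[R]_n -> R -> R^o) :
  cell_mul h1 h2 v - cell_mul h1 h2 w = cell_mul h1 h2 (v - w).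
Proof. by apply/funext => y; apply/funext => z; rewrite /cell_mul mulrBr. Qed.

(* [f] is an a.e. limit of simple functions, so that joint measurability is
   only obtained after discarding a null set of [x]. *)
Lemma cell_mul_representative (Omega : set 'rV[R]_n) (q : R)
    (f : 'rV[R]_n -> AC) : 0 < q -> Bochner (leb n) Omega q f ->
  exists N : set 'rV[R]_n,
    let g x y z := \1_(~` N) x * cell_mul h1 h2 (f x) y z in
    [/\ measurable N, leb n N = 0%E,
      Bochner (leb n) Omega q (g : 'rV[R]_n -> A_space A (Lp_space I q)) &
      measurable_fun ((Omega `*` setT) `*` I)
        (fun z : 'rV[R]_n * 'rV[R]_n * R => g z.1.1 z.1.2 z.2)].
Proof.
move=> q0 [[s ss [N [mN N0 sN]]] fA fy].
have sf x : ~ N x -> Omega x -> fnrm AC (f x - s k x) @[k --> \oo] --> 0%E.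
  by move=> Nx; apply: contrapT => fx; apply: Nx; apply: sN.
exists N => g.
have gE x : ~ N x -> g x = cell_mul h1 h2 (f x).
  move=> Nx; apply/funext => y; apply/funext => z.
  by rewrite /g indicE mem_set ?mul1r.
have aeN (Q : 'rV[R]_n -> Prop) : (forall x, ~ N x -> Q x) -> {ae leb n, forall x, Q x}.
  by move=> NQ; exists N; split=> // x; apply: contra_notP => /NQ.
have [c c0 cle] := sup_norm_cell_mul_le q0.
have cellA (v : AC) : felt AC v -> felt (A_space A (Lp_space I q)) (cell_mul h1 h2 v).
  exact: A_space_cell_mul.
split; [exact: mN|exact: N0| |]; last first.
  (* Off [N], sup-norm convergence of [s k x] gives convergence at every [(y, z)]; on [N] all terms
     vanish. *)
  pose hk k (z : 'rV[R]_n * 'rV[R]_n * R) : R :=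
    \1_(~` N) z.1.1 * (\1_J (z.1.2, z.2) * s k z.1.1 z.1.2 z.2).
  apply: (@measurable_fun_cvg _ _ _ _ hk) => [k|[[x y] z] [[Ox _] Iz]].
    apply: measurable_funM.
      apply: measurable_funTS.
      apply: (@measurableT_comp _ _ _ _ _ _ (\1_(~` N) : 'rV[R]_n -> R) _
        (fun z : 'rV[R]_n * 'rV[R]_n * R => z.1.1)).
        by apply: measurable_indic; exact: measurableC.
      exact: measurableT_comp.
    apply: measurable_funM; last exact: measurable_simple_on_A_C.
    apply: measurable_funTS.
    apply: (@measurableT_comp _ _ _ _ _ _ (\1_J : 'rV[R]_n * R -> R) _
      (fun z : 'rV[R]_n * 'rV[R]_n * R => (z.1.2, z.2))).
      by apply: measurable_indic; exact: (measurable_reference_cell A_amv).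
    by apply: measurable_fun_pair => //; exact: measurableT_comp.
  rewrite /hk /g /cell_mul/=; have [Nx|Nx] := pselect (N x).
    rewrite indicE memNset ?mul0r; last by move=> /(_ Nx).
    under eq_fun do rewrite mul0r.
    exact: cvg_cst.
  apply: cvgZr; apply: cvgZr.
  apply: (@cvg_of_le_cvge0 _ (fun k => fnrm AC (f x - s k x))); last exact: sf.
  move=> k; apply: le_trans (le_sup_norm _ y).
  exact: (le_C_norm _ (subset_closure Iz)).
split.
- exists (fun k x => cell_mul h1 h2 (s k x)).
    move=> k; have [fs ms sA] := ss k; split.
    + rewrite (_ : _ @` _ = cell_mul h1 h2 @` (s k @` Omega)).
        exact: finite_image.
      by rewrite image_comp.
    (* Multiplication may identify several values of [s k], so a level set is a finite union of its
       level sets. *)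
    + move=> v; rewrite (_ : _ `&` _ = \bigcup_(w in s k @` Omega `&`
          [set w | cell_mul h1 h2 w = v]) (Omega `&` s k @^-1` [set w])).
        apply: fin_bigcup_measurable => [|w _]; last exact: ms.
        exact: finite_setIl.
      apply/seteqP; split=> [x [Ox sxv]|x [w [_ wv] [Ox sw]]].
        by exists (s k x); [split=> //; exists x|].
      by split=> //=; rewrite sw.
    + by move=> x Ox; apply: cellA; exact: sA.
  apply: aeN => x Nx Ox; rewrite gE//.
  apply: (@squeeze_cvge _ _ _ _ (fun=> 0%E) _ (fun k => c%:E * fnrm AC (f x - s k x))%E).
  + apply: nearW => k; apply/andP; split; last first.
      by rewrite cell_mulB; exact: cle.
    apply: le_trans (le_sup_norm _ 0); exact: Lnorm_ge0.
  + exact: cvg_cst.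
  + by rewrite -(mule0 c%:E); apply: cvgeZl => //; exact: sf.
- have : {ae leb n, forall x, ~ N x} by apply: aeN.
  apply: filterS2 fA => x fA Nx Ox; rewrite gE//; apply: cellA; exact: fA.
apply: ae_le_Lnorm_lty c0 _ fy => //.
apply: aeN => x Nx; rewrite !patchE; case: ifPn => _; last by rewrite abse0 mule0.
rewrite gE// !gee0_abs; first exact: cle.
- by apply: le_trans (le_sup_norm _ 0); exact: C_norm_ge0.
- by apply: le_trans (le_sup_norm _ 0); exact: Lnorm_ge0.
Qed.

End cell_multiplier_Bochner.

(** * Rescaling of the thin domain and passage to the limit *)

Lemma ae_fst_notin d1 d2 (T1 : measurableType d1) (T2 : measurableType d2)
    (R : realType) (m1 : {measure set T1 -> \bar R})
    (m2 : {sigma_finite_measure set T2 -> \bar R}) (N : set T1) :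
  measurable N -> m1 N = 0%E -> {ae (m1 \x m2)%E, forall x, ~ N x.1}.
Proof.
move=> mN N0; exists (N `*` setT); split.
- exact: measurableX.
- by rewrite product_measure1E// N0 mul0e.
- by move=> x /= /contrapT Nx.
Qed.

Section rescaled_cell.
Context (R : realType) (n : nat) (Omega : set 'rV[R]_n).
Context (h1 h2 : 'rV[R]_n -> R) (eps : R) (eps0 : 0 < eps).

Lemma thin_domainE x : thin_domain Omega h1 h2 eps x <->
  Omega x.1 /\ reference_cell h1 h2 (eps^-1 *: x.1, eps^-1 * x.2).
Proof.
by rewrite /thin_domain /reference_cell/= ltr_pdivlMl// ltr_pdivrMl.
Qed.

Lemma sub_thin_domain_cylinder (A : set ('rV[R]_n -> R)) :
  algebra_with_mean_value A -> A h1 -> A h2 ->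
  thin_domain Omega h1 h2 eps `<=` thin_cylinder Omega (height_itv h1 h2) eps.
Proof.
move=> A_amv h1_A h2_A x /thin_domainE[Ox /andP[xh1 xh2]]; split=> //.
exists (eps^-1 * x.2); last by rewrite mulVKf// gt_eqF.
rewrite /height_itv/= in_itv/=; apply/andP; split.
- exact: le_lt_trans (inf_le_height A_amv h1_A _) xh1.
- exact: lt_le_trans xh2 (height_le_sup A_amv h2_A _).
Qed.

End rescaled_cell.

Theorem theorem1p2 (R : realType) (d : nat) (d_ge2 : (2 <= d)%N)
  (Omega : set 'rV[R]_d.-1) (Omega_dom : bounded_lipschitz_domain Omega)
  (A : set ('rV[R]_d.-1 -> R)) (A_amv : algebra_with_mean_value A)
  (h1 h2 : 'rV[R]_d.-1 -> R)
  (h1_W : W1infty h1) (h1_A : A h1) (h1_lip : lipschitz h1)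
  (h2_W : W1infty h2) (h2_A : A h2) (h2_lip : lipschitz h2)
  (h12 : inf (range h1) <= 0 <= sup (range h2))
  (p p' : R) (p_gt1 : 1 < p) (pp' : p'^-1 = 1 - p^-1)
  (E : nat -> R) (E_ord : ordinary_sequence E)
  (u : R -> 'rV[R]_d.-1 * R -> R)
  (u_Lp : forall k, Lp (leb d.-1 \x lebesgue_measure)%E
     (thin_domain Omega h1 h2 (E k)) p (u (E k)))
  (C : R) (C_gt0 : 0 < C)
  (u_bound : forall k, ((E k `^ (- p^-1))%:E *
     Lp_norm (leb d.-1 \x lebesgue_measure)
       (thin_domain Omega h1 h2 (E k)) p (u (E k)) <= C%:E)%E)
  (P : R -> ('rV[R]_d.-1 * R -> R) -> 'rV[R]_d.-1 * R -> R)
  (C' : R) (C'_gt0 : 0 < C')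
  (P_ext : forall k, extension_operator (leb d.-1 \x lebesgue_measure)%E
     (thin_domain Omega h1 h2 (E k))
     (thin_cylinder Omega (height_itv h1 h2) (E k)) p C' (P (E k)))
  (sigma : nat -> nat) (sigma_incr : {homo sigma : i j / (i < j)%N})
  (u0 : 'rV[R]_d.-1 -> 'rV[R]_d.-1 -> R -> R)
  (u0_Lp : Bochner (leb d.-1) Omega p
     (u0 : 'rV[R]_d.-1 -> B_space A p (Lp_space (height_itv h1 h2) p)))
  (Pu_cvg : weak_sigma_cvg A Omega (height_itv h1 h2) p' (E \o sigma)
     (fun eps => P eps (u eps)) u0)
  (f : 'rV[R]_d.-1 -> 'rV[R]_d.-1 -> R -> R)
  (f_Lp' : Bochner (leb d.-1) Omega p'
     (f : 'rV[R]_d.-1 -> A_space A (C_space (closure (height_itv h1 h2))))) :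
  (E (sigma k))^-1 *
    \int[(leb d.-1 \x lebesgue_measure)%E]_(x in
        thin_domain Omega h1 h2 (E (sigma k)))
      (u (E (sigma k)) x *
       f x.1 ((E (sigma k))^-1 *: x.1) ((E (sigma k))^-1 * x.2))
    @[k --> \oo] -->
  mean_integral A Omega (height_itv h1 h2)
    (fun x y z => \1_(reference_cell h1 h2) (y, z) * u0 x y z * f x y z).
Proof.
have p'_gt0 : 0 < p'.
  by rewrite -invr_gt0 pp' subr_gt0 invf_lt1// (lt_trans ltr01).
have [N [mN N0 gB gm]] := cell_mul_representative A_amv h1_A h2_A p'_gt0 f_Lp'.
have gE x y z : ~ N x ->
    \1_(~` N) x * cell_mul h1 h2 (f x) y z = \1_(reference_cell h1 h2) (y, z) * f x y z.
  by move=> Nx; rewrite indicE mem_set// mul1r.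
(* The representative of [1_J f] is the test function; it remains to identify both sides of this
   limit. *)
have := Pu_cvg _ gB gm.
set v := fun k : nat => _ * _; set w := fun k : nat => _ * _.
have -> : v = w.
  apply/funext => k; rewrite /v /w/=; congr (_ * _).
  have [eps0 _] := andP (E_ord.1 (sigma k)).
  have [_ Pu _ _] := P_ext (sigma k).
  apply: ae_eq_Rintegral.
  have aeN := @ae_fst_notin _ _ _ _ _ (leb d.-1) (@lebesgue_measure R) _ mN N0.
  apply: filterS2 aeN (Pu _ (u_Lp (sigma k))) => x Nx Pux; rewrite !patchE.
  (* In the thin domain the extension equals [u] and the indicator is 1; in the rest of the cylinder
     the indicator is 0. *)
  have [thin|thin] := pselect (thin_domain Omega h1 h2 (E (sigma k)) x).
    have cyl := sub_thin_domain_cylinder eps0 A_amv h1_A h2_A thin.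
    have [_ xJ] := (thin_domainE _ _ _ eps0 _).1 thin.
    by rewrite (mem_set thin) (mem_set cyl) Pux// gE// indicE (mem_set xJ) mul1r.
  rewrite (memNset thin); case: ifPn => // /set_mem[Ox _].
  rewrite gE// indicE memNset ?mul0r ?mulr0// => xJ; apply: thin.
  exact/(thin_domainE _ _ _ eps0).
suff -> : mean_integral A Omega (height_itv h1 h2)
      (fun x y z => u0 x y z * (\1_(~` N) x * cell_mul h1 h2 (f x) y z)) =
    mean_integral A Omega (height_itv h1 h2)
      (fun x y z => \1_(reference_cell h1 h2) (y, z) * u0 x y z * f x y z) by [].
apply: ae_eq_Rintegral; exists N; split; [exact: mN|exact: N0|].
move=> x; apply: contra_notP => Nx.
have uE : (fun y z => u0 x y z * (\1_(~` N) x * cell_mul h1 h2 (f x) y z)) =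
    (fun y z => \1_(reference_cell h1 h2) (y, z) * u0 x y z * f x y z).
  by apply/funext => y; apply/funext => z; rewrite gE// mulrCA mulrA.
(* For [x] off [N] the two integrands are the same function of [(y, z)], so the mean values selected
   for them coincide. *)
pose Phi (t : 'rV[R]_d.-1 -> R -> R) : R :=
  \int[lebesgue_measure]_(z in height_itv h1 h2)
    (mean_value A (t : 'rV[R]_d.-1 -> Lp_space (height_itv h1 h2) 1) : R -> R) z.
by rewrite /patch /=; case: (x \in Omega); [exact: (congr1 Phi uE)|].
Qed.
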